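(* Let $n,p,c$ be positive integers and $b=pc+1$. Let $\{\sigma(k)\}_{k\ge0}$ be the random walk on $G_{p,n}$ generated by the $(b,n,p)$-shuffle, and let $P_s=\{P_s(\mu,\tau)\}_{\mu,\tau\in G_{p,n}}$, $P_s(\mu,\tau)=\mathbf{P}(\sigma(k+1)=\tau\mid\sigma(k)=\mu)$, be its transition probability matrix. Let $\ell=n$ if $p\ne1$ and $\ell=n-1$ if $p=1$. Then: (1) The set of eigenvalues of $P_s$ is $\{b^{-j}\}_{j=0}^{\ell}$, and for each $j$ the left (resp. right) eigenspace for $b^{-j}$ is $\mathrm{Range}\,L(e_{\ell-j})$ (resp. $\mathrm{Range}\,L(f_{\ell-j})$), where $L(A)$ denotes the left regular representation of $A\in\mathbf{C}[G_{p,n}]$. (2) The multiplicity of the eigenvalue $b^{-j}$ is equal to $u_{0j}\,p^n\,n!$, which is equal to the Stirling–Frobenius cycle number $\mathrm{SFC}_p(n,n-j)$.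
   Context: Colored permutations. Let $[n]=\{1,\dots,n\}$, $\Sigma=[n]\times\mathbf{Z}_p$ with $\mathbf{Z}_p=\mathbf{Z}/p\mathbf{Z}$ (elements represented by $0,\dots,p-1$), and $T_q(i,r)=(i,r+q)$. $G_{p,n}$ is the group (under composition) of bijections $\sigma:\Sigma\to\Sigma$ with $\sigma\circ T_1=T_1\circ\sigma$. An element $\sigma$ is determined by the pairs $(\sigma(i),\sigma_c(i)):=\sigma(i,0)$, $i\in[n]$. d-descents. Order $\Sigma$ linearly by $(1,0)<\cdots<(n,0)<(1,p-1)<\cdots<(n,p-1)<(1,p-2)<\cdots<(n,p-2)<\cdots<(1,1)<\cdots<(n,1)$. $\sigma\in G_{p,n}$ has a d-descent at $i$, for $1\le i\le n-1$, iff $(\sigma(i),\sigma_c(i))>(\sigma(i+1),\sigma_c(i+1))$, and a d-descent at $n$ iff $\sigma_c(n)\ne0$. Let $d(\sigma)$ be the number of d-descents of $\sigma$; $d(\sigma)\in\{0,\dots,\ell\}$. $(b,n,p)$-shuffle. The random element of $G_{p,n}$ obtained as follows: choose $(A_1,\dots,A_n)$ uniformly in $\{0,\dots,b-1\}^n$; arrange the labels in ascending order $A_{i(1)}\le\cdots\le A_{i(n)}$, equal labels being kept in increasing order of index; set $\sigma(i(m))=m$ for $m=1,\dots,n$ and $\sigma_c(i)\equiv A_i\pmod p$. Random walk. $\sigma(0)=\mathrm{id}$ and $\sigma(k)=S_k\circ\sigma(k-1)$, where $S_1,S_2,\dots$ are independent $(b,n,p)$-shuffles; thus $P_s(\mu,\tau)$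 is the probability that the $(b,n,p)$-shuffle equals $\tau\mu^{-1}$. Elements of the group algebra. For $i=0,\dots,\ell$ let $$D_i=\sum_{d(\sigma)=i}\sigma,\qquad \Theta_i=\sum_{d(\sigma^{-1})=i}\sigma\quad\text{in }\mathbf{C}[G_{p,n}].$$ With $\binom{y}{n}=y(y-1)\cdots(y-n+1)/n!$, define $e_0,\dots,e_\ell$ and $f_0,\dots,f_\ell\in\mathbf{C}[G_{p,n}]$ by the polynomial identities in $x$ $$\sum_{i=0}^{\ell}\binom{n+\frac{x-1}{p}-i}{n}\Theta_i=\sum_{k=0}^{\ell}x^{n-k}e_{\ell-k},\qquad \sum_{i=0}^{\ell}\binom{n+\frac{x-1}{p}-i}{n}D_i=\sum_{k=0}^{\ell}x^{n-k}f_{\ell-k}.$$ (At $x=b$, dividing by $b^n$, these equal $\sum_\sigma P((b,n,p)\text{-shuffle}=\sigma)\,\sigma$ and $\sum_\sigma P(((b,n,p)\text{-shuffle})^{-1}=\sigma)\,\sigma$, respectively.) Row and column vectors $h:G_{p,n}\to\mathbf{C}$ are identified with $\sum_\sigma h(\sigma)\sigma\in\mathbf{C}[G_{p,n}]$; $L(A)$ is the operator $x\mapsto Ax$ on $\mathbf{C}[G_{p,n}]$. A left (right) eigenvector of $P_s$ is a row (column) vector $h$ with $hP_s=\lambda h$ ($P_sh=\lambda h$). $u_{0j}$ denotes the coefficient of $x^{n-j}$ in $\binom{n+\frac{x-1}{p}}{n}$. Stirling–Frobenius cycle numbers with parameter $p$: $\mathrm{SFC}_p(0,0)=1$, $\mathrm{SFC}_p(m,r)=0$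 for $r<0$ or $r>m$, and $\mathrm{SFC}_p(m,r)=\mathrm{SFC}_p(m-1,r-1)+(pm-1)\,\mathrm{SFC}_p(m-1,r)$ for $m\ge1$. *)

(* Defs.v *)
From HB Require Import structures.
From mathcomp Require Import all_boot all_order all_fingroup all_algebra.
From mathcomp Require Import ring.

Set Implicit Arguments.
Unset Strict Implicit.
Unset Printing Implicit Defensive.

Import GRing.Theory.
Local Open Scope ring_scope.

(* Everything is 0-based: [n] is 'I_n and Z_p is 'I_p (not 'Z_p, which is
   Z/2Z when p = 1), with addition of 1 in Z_p given by the cyclic successor
   ordS. *)
Definition csym n p : finType := ('I_n * 'I_p)%type.

Definition shift n p (x : csym n p) : csym n p := (x.1, ordS x.2).

Lemma shift_inj n p : injective (@shift n p).
Proof. by move=> [i r] [j s] [-> eq_rs]; congr pair; apply/ordS_inj/val_inj. Qed.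

Definition shift_perm n p : {perm csym n p} := perm (@shift_inj n p).

(* The bijections of csym n p that commute with T_1. *)
Definition cperm n p : finGroupType := [subg 'C[shift_perm n p]].

Definition cact n p (s : cperm n p) (x : csym n p) : csym n p := val s x.

(* MathComp permutations multiply from left to right: (s * t) x = t (s x). *)
Definition comp n p (s t : cperm n p) : cperm n p := (t * s)%g.

Lemma compE n p (s t : cperm n p) x : cact (comp s t) x = cact s (cact t x).
Proof. exact: permM. Qed.

Lemma cact_shift n p (s : cperm n p) x : cact s (shift x) = shift (cact s x).
Proof.
have /cent1P := valP s; move=> /permP/(_ x).
by rewrite !permM !permE.
Qed.

Definition color0 p (p_gt0 : (0 < p)%N) : 'I_p := Ordinal p_gt0.

(* The place of the color r in the ordering 0, p - 1, p - 2, ..., 1. *)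
Definition color_rank p (r : 'I_p) : nat := ((p - r) %% p)%N.

Definition csym_lt n p (x y : csym n p) : bool :=
  (color_rank x.2 < color_rank y.2)%N
  || (color_rank x.2 == color_rank y.2) && (x.1 < y.1)%N.

(* When i is not the last index, ordS i is i + 1. *)
Definition ddescent n p (p_gt0 : (0 < p)%N) (s : cperm n p) (i : 'I_n) : bool :=
  let img j := cact s (j, color0 p_gt0) in
  if i.+1 == n then (img i).2 != color0 p_gt0
  else csym_lt (img (ordS i)) (img i).

Definition ndesc n p (p_gt0 : (0 < p)%N) (s : cperm n p) : nat :=
  #|[set i | ddescent p_gt0 s i]|.

Definition ell n p : nat := if p == 1%N then n.-1 else n.

Definition word b n : finType := {ffun 'I_n -> 'I_b}.

(* The list i(1), ..., i(n); the sorting function of path.v is stable. *)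
Definition stack b n (A : word b n) : seq 'I_n :=
  sort (fun i j => A i <= A j)%N (enum 'I_n).

Lemma mem_stack b n (A : word b n) i : i \in stack A.
Proof. by rewrite mem_sort mem_enum. Qed.

Lemma place_subproof b n (A : word b n) i : (index i (stack A) < n)%N.
Proof. by have := mem_stack A i; rewrite -index_mem size_sort size_enum_ord. Qed.

Definition place b n (A : word b n) i : 'I_n := Ordinal (place_subproof A i).

Lemma place_inj b n (A : word b n) : injective (place A).
Proof. by move=> i j [eq_ij]; apply: (index_inj i) eq_ij; apply: mem_stack. Qed.

Lemma color_shift_subproof p (a : nat) (r : 'I_p) : ((a + r) %% p < p)%N.
Proof. by rewrite ltn_mod (leq_ltn_trans _ (ltn_ord r)). Qed.

Definition color_shift p (a : nat) (r : 'I_p) : 'I_p :=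
  Ordinal (color_shift_subproof a r).

Definition shuffle_fun b n p (A : word b n) (x : csym n p) : csym n p :=
  (place A x.1, color_shift (A x.1) x.2).

Lemma shuffle_fun_inj b n p (A : word b n) : injective (@shuffle_fun b n p A).
Proof.
move=> [i r] [j s] [/= eq_ij /eqP]; have <- : i = j.
  by apply: (@place_inj _ _ A); apply: val_inj.
by rewrite eqn_modDl !modn_small // => /eqP/val_inj ->.
Qed.

Lemma shuffle_subproof b n p (A : word b n) :
  perm (@shuffle_fun_inj b n p A) \in 'C[shift_perm n p]%G.
Proof.
apply/cent1P/permP=> -[i r]; rewrite !permM !permE; congr pair.
by apply: val_inj; rewrite /= -addn1 modnDml addn1 modnDmr addnS.
Qed.

Definition shuffle b n p (A : word b n) : cperm n p :=
  Subg (@shuffle_subproof b n p A).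

Definition shuffle_law (C : numClosedFieldType) b n p (s : cperm n p) : C :=
  #|[set A : word b n | shuffle p A == s]|%:R / (b ^ n)%:R.

Definition walk b n p (w : seq (word b n)) : cperm n p :=
  foldl (fun s A => comp (shuffle p A) s) 1%g w.

Definition trans (C : numClosedFieldType) b n p (mu tau : cperm n p) : C :=
  shuffle_law C b (comp tau mu^-1%g).

(* P(sigma(k) = mu and sigma(k+1) = tau) = P(sigma(k) = mu) P_s(mu, tau) for
   the walk driven by a uniform sequence of words. *)
Lemma walk_trans (C : numClosedFieldType) b n p k (mu tau : cperm n p) :
  #|[set v : k.-tuple (word b n) * word b n |
      (walk p v.1 == mu) && (walk p (rcons v.1 v.2) == tau)]|%:R
    / #|{: k.-tuple (word b n) * word b n}|%:R
  = #|[set w : k.-tuple (word b n) | walk p w == mu]|%:R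
      / #|{: k.-tuple (word b n)}|%:R * trans C b mu tau.
Proof.
set B := [set A : word b n | shuffle p A == comp tau mu^-1%g].
rewrite (_ : [set v | _] = setX [set w : k.-tuple (word b n) | walk p w == mu] B); last first.
  apply/setP=> -[w A]; rewrite !inE /=; case: eqP => //= eq_mu.
  rewrite /walk -cats1 foldl_cat /= -/(walk p w) eq_mu /comp.
  by rewrite eq_sym [RHS]eq_sym (can2_eq (mulKVg mu) (mulKg mu)).
rewrite cardsX card_prod !natrM invfM mulrACA; congr (_ * (_ / _%:R)).
by rewrite card_ffun !card_ord.
Qed.

Definition trans_mx (C : numClosedFieldType) b n p : 'M[C]_#|cperm n p| :=
  \matrix_(i, j) trans C b (enum_val i) (enum_val j).

(* The element \sum_s x_s s of C[G_{p,n}] is the function s |-> x_s.  The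
   scalars form any numClosedFieldType, e.g. the field R[i] of complex
   numbers. *)
Definition galg (C : numClosedFieldType) n p := {ffun cperm n p -> C^o}.

Definition gmul (C : numClosedFieldType) n p (x y : galg C n p) : galg C n p :=
  [ffun s => \sum_(ab : cperm n p * cperm n p | comp ab.1 ab.2 == s)
               x ab.1 * y ab.2].

Definition in_range_L (C : numClosedFieldType) n p (A h : galg C n p) : Prop :=
  exists x : galg C n p, h = gmul A x.

Definition row_galg (C : numClosedFieldType) n p (h : 'rV[C]_#|cperm n p|) :
    galg C n p :=
  [ffun s => h 0 (enum_rank s)].

Definition col_galg (C : numClosedFieldType) n p (h : 'cV[C]_#|cperm n p|) :
    galg C n p :=
  [ffun s => h (enum_rank s) 0].

Definition Dsum (C : numClosedFieldType) n p (p_gt0 : (0 < p)%N) (i : nat) :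
    galg C n p :=
  [ffun s => (ndesc p_gt0 s == i)%:R].

Definition Theta (C : numClosedFieldType) n p (p_gt0 : (0 < p)%N) (i : nat) :
    galg C n p :=
  [ffun s => (ndesc p_gt0 s^-1%g == i)%:R].

Definition binp (C : numClosedFieldType) (n : nat) (y : {poly C}) : {poly C} :=
  n`!%:R^-1 *: \prod_(k < n) (y - k%:R%:P).

(* The polynomial binomial(n + (x - 1) / p - i, n) in x. *)
Definition shuffle_poly (C : numClosedFieldType) (n p i : nat) : {poly C} :=
  binp n (n%:R%:P + p%:R^-1 *: ('X - 1) - i%:R%:P).

(* The family (g_0, ..., g_ell) such that
   \sum_i binomial(n + (x - 1) / p - i, n) F_i = \sum_k x^(n - k) g_(ell - k);
   g_m is the coefficient of x^(n - (ell - m)).  See xcoefE. *)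
Definition xcoef (C : numClosedFieldType) n p (F : nat -> galg C n p) (m : nat) :
    galg C n p :=
  \sum_(i < (ell n p).+1) (shuffle_poly C n p i)`_(n - (ell n p - m)) *: F i.

Definition e_ (C : numClosedFieldType) n p (p_gt0 : (0 < p)%N) : nat -> galg C n p :=
  xcoef (Theta C n p_gt0).

Definition f_ (C : numClosedFieldType) n p (p_gt0 : (0 < p)%N) : nat -> galg C n p :=
  xcoef (Dsum C n p_gt0).

Lemma size_shuffle_poly (C : numClosedFieldType) n p i :
  (size (shuffle_poly C n p i) <= n.+1)%N.
Proof.
apply: leq_trans (size_scale_leq _ _) _.
apply: leq_trans (size_poly_prod_leq _ _) _; rewrite card_ord leq_subLR addnS ltnS.
rewrite [leqRHS](_ : _ = \sum_(k < n) 2)%N; last first.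
  by rewrite sum_nat_const card_ord muln2 addnn.
apply: leq_sum => k _; set q : {poly C} := _ - k%:R%:P.
have -> : q = p%:R^-1 *: 'X + (n%:R - p%:R^-1 - i%:R - k%:R)%:P.
  by rewrite /q scalerBr alg_polyC !polyCB; ring.
rewrite (leq_trans (size_polyD _ _)) // geq_max.
rewrite (leq_trans (size_scale_leq _ _)) ?size_polyX //=.
exact: leq_trans (size_polyC_leq1 _) _.
Qed.

Lemma xcoefE (C : numClosedFieldType) n p (F : nat -> galg C n p) (x : C) :
  (0 < n)%N ->
  \sum_(i < (ell n p).+1) (shuffle_poly C n p i).[x] *: F i
  = \sum_(k < (ell n p).+1) x ^+ (n - k) *: xcoef F (ell n p - k).
Proof.
move=> n_gt0; rewrite /xcoef; under [RHS]eq_bigr => k _ do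
  rewrite scaler_sumr subKn 1?leq_ord //.
rewrite exchange_big /=; apply: eq_bigr => i _.
under eq_bigr => k _ do rewrite scalerA mulrC.
rewrite -scaler_suml (horner_coef_wide _ (size_shuffle_poly _ _ _ _)).
congr (_ *: _); rewrite (reindex_inj rev_ord_inj) /=.
under eq_bigr => k _ do rewrite subSS.
rewrite -(big_mkord xpredT (fun k => _`_(n - k) * x ^+ (n - k))).
rewrite -(big_mkord xpredT (fun k => _`_(n - k) * x ^+ (n - k))).
move: (nat_of_ord i) (ltn_ord i) => {}i; rewrite /ell; case: eqP => // -> le_i_n.
rewrite prednK // in le_i_n.
rewrite [in RHS]prednK // big_nat_recr //= subnn expr0 mulr1 -horner_coef0.
rewrite [X in _ + X](_ : _ = 0) ?addr0 //.
rewrite /shuffle_poly /binp hornerZ horner_prod; apply/eqP.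
rewrite mulf_eq0; apply/orP; right; rewrite prodf_seq_eq0.
apply/hasP; exists (rev_ord (Ordinal le_i_n)).
  exact: mem_index_enum.
rewrite !hornerE invr1 /= natrB // -[i.+1]addn1 natrD; apply/eqP; ring.
Qed.

Definition u0 (C : numClosedFieldType) (n p j : nat) : C :=
  (shuffle_poly C n p 0)`_(n - j).

Fixpoint SFC (p m r : nat) : nat :=
  match m with
  | 0%N => (r == 0)%N
  | m'.+1 => ((if r is r'.+1 then SFC p m' r' else 0)
              + (p * m - 1) * SFC p m' r)%N
  end.

(* Main.v *)
Require Import Defs.
From mathcomp Require Import all_boot all_order all_fingroup all_algebra.
From mathcomp Require Import zify ring.

Set Implicit Arguments.
Unset Strict Implicit.
Unset Printing Implicit Defensive.

Import GRing.Theory Num.Theory.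
Local Open Scope ring_scope.

(** A shuffle matrix is a polynomial in the number of piles, and composing
    shuffles multiplies these numbers; all the rest follows from comparing
    coefficients.

    Let [b = p c + 1].  A word [A] with shuffle [s] is found by listing its
    letters in the order in which [s^-1] lists the cards: they must increase
    weakly, have prescribed residues modulo [p], and increase strictly where
    two consecutive cards are in the wrong order.  Writing each letter as
    [p q + r], the quotients [q] form a weakly increasing sequence in [0, c]
    that is forced to rise at every d-descent of [s^-1] before [n], while a
    d-descent at [n] forces the last quotient to stay below [c].  Hence there are
    [binomial (n + c - d(s^-1), n)] such words ([card_words],
    [card_shuffle]).  As [c = (b - 1) / p] this is a polynomial in [b], and
    the matrix [S_b] that counts words is [\sum_k b^(n-k) E_k], where [E_k]
    is left multiplication by [e_(l-k)] on row vectors ([shuffle_mxE]).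
    Transposing the action inverts group elements, so on column vectors the
    same [E_k] is left multiplication by [f_(l-k)].

    A shuffle with [b1] piles followed by one with [b2] piles is a shuffle with
    [b1 b2] piles, because sorting by one letter and then stably by another is
    sorting by the number that has these two letters as digits
    ([comp_shuffle]); the colors agree because [b1] is 1 modulo [p].  So
    [S_b1 S_b2 = S_(b2 b1)] for infinitely many [b1] and [b2], and comparing
    coefficients of [b1^(n-j) b2^(n-k)] shows that the [E_k] are orthogonal
    idempotents.  They add up to [S_1 = 1].  Therefore
    [P_s = b^-n S_b = \sum_k b^-k E_k] is a spectral resolution, which gives
    the eigenvalues and both families of eigenspaces.

    The rank of the idempotent [E_k] is its trace, the group order times the
    coefficient of [e_(l-k)] at the identity, and that coefficient is [u_0k]
    since the identity has no d-descents.  The group order itself comes from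
    [E_0], all of whose entries equal the leading coefficient [1 / (p^n n!)]:
    such a matrix is idempotent only if its size is [p^n n!]
    ([card_cperm]).  Finally [p^n n! binomial (n + (x-1)/p, n)] is the product
    of the [x + (p m - 1)] for [1 <= m <= n], whose coefficients obey the
    recurrence of the Stirling-Frobenius numbers; they are positive in the
    relevant range, so no [E_k] vanishes. *)

(** * Stable sorting of words *)

Local Open Scope nat_scope.

Definition lexlt (v x w y : nat) : bool := (v < w) || (v == w) && (x < y).

Definition wordlt b n (A : word b n) (i j : 'I_n) : bool := lexlt (A i) i (A j) j.

Lemma wordlt_trans b n (A : word b n) : transitive (wordlt A).
Proof. by move=> j i k; rewrite /wordlt /lexlt; lia. Qed.

Lemma wordlt_irr b n (A : word b n) i : wordlt A i i = false.
Proof. by rewrite /wordlt /lexlt; lia. Qed.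

(** The sort is stable, so the stack lists the indices by increasing letter,
    ties being broken by the index. *)
Lemma place_lt b n (A : word b n) i j :
  (place A i < place A j) = wordlt A i j.
Proof.
have srt : sorted (wordlt A) (stack A).
  have tot : total (fun i j : 'I_n => A i <= A j) by move=> x y; apply: leq_total.
  have tr : transitive (fun i j : 'I_n => i < j) by move=> y x z; apply: ltn_trans.
  apply: sub_sorted (sort_stable tot tr _) => [x y /=|].
    by rewrite /wordlt /lexlt; case: (ltngtP (A x) (A y)).
  by have := iota_ltn_sorted 0 n; rewrite -val_enum_ord sorted_map.
have imp x y : place A x < place A y -> wordlt A x y.
  by move=> lt_xy; apply: (sorted_ltn_index (@wordlt_trans _ _ A) srt);
     rewrite ?mem_stack.
apply/idP/idP; first exact: imp.
case: (ltngtP (place A i) (place A j)) => // [/imp ji ij|/val_inj/place_inj ->].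
  by have := wordlt_trans ij ji; rewrite wordlt_irr.
by rewrite wordlt_irr.
Qed.

(** Makes an injective self-map of an ordinal recoverable from the comparisons
    between its values. *)
Lemma ord_inj_rank n (f : 'I_n -> 'I_n) i : injective f ->
  f i = #|[set j | f j < f i]| :> nat.
Proof.
move=> injf; rewrite -(card_imset _ injf).
rewrite (_ : f @: _ = [set k : 'I_n | k < f i]); last first.
  apply/setP=> k; rewrite inE; apply/imsetP/idP => [[j]|ltk].
    by rewrite inE => ltj ->.
  by exists (invF injf k); rewrite ?inE f_invF.
rewrite -sum1_card; under eq_bigl do rewrite inE.
rewrite (big_ord_narrow (ltnW (ltn_ord (f i)))).
by rewrite sum1_card card_ord.
Qed.

Lemma ord_inj_eq n (f g : 'I_n -> 'I_n) : injective f -> injective g ->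
  (forall i j, f i < f j -> g i < g j) -> f =1 g.
Proof.
move=> injf injg mono i; apply: val_inj.
rewrite /= (ord_inj_rank i injf) (ord_inj_rank i injg); congr #|pred_of_set _|.
apply/setP=> j; rewrite !inE; apply/idP/idP; first exact: mono.
case: (ltngtP (f i) (f j)) => // [/mono lt|/val_inj/injf ->].
  by rewrite ltnNge ltnW.
by rewrite ltnn.
Qed.

(** A bijection compatible with the sorting order has no choice; placements are
    identified in this way below. *)
Lemma place_eq b n (A : word b n) (f : 'I_n -> 'I_n) : injective f ->
  (forall i j, wordlt A i j -> f i < f j) -> place A =1 f.
Proof.
move=> injf mono; apply: ord_inj_eq injf _; first exact: place_inj.
by move=> i j; rewrite place_lt; apply: mono.
Qed.

Lemma ordS_val n (m : 'I_n) : m.+1 < n -> ordS m = m.+1 :> nat.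
Proof. by move=> lt; rewrite /= modn_small. Qed.

Lemma homo_ordS n T (r : rel T) (f : 'I_n -> T) : transitive r ->
  (forall m : 'I_n, m.+1 < n -> r (f m) (f (ordS m))) ->
  forall m m' : 'I_n, m < m' -> r (f m) (f m').
Proof.
move=> tr step m [k ltk] /=; elim: k ltk => // k IH ltk.
have ltk' : k < n by apply: ltnW.
have {step}stp := step (Ordinal ltk') ltk.
have eqS : ordS (Ordinal ltk') = Ordinal ltk by apply: val_inj; apply: ordS_val.
rewrite eqS in stp; rewrite ltnS leq_eqVlt => /orP[/eqP eqm|/(IH ltk') rm].
  by rewrite (_ : m = Ordinal ltk') //; apply: val_inj.
exact: tr rm stp.
Qed.

Lemma increasing_geq n (f : 'I_n -> nat) :
  (forall m : 'I_n, m.+1 < n -> f m < f (ordS m)) -> forall m : 'I_n, m <= f m.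
Proof.
move=> step [k ltk] /=; elim: k ltk => // k IH ltk.
have ltk' : k < n by apply: ltnW.
have := step (Ordinal ltk') ltk.
have -> : ordS (Ordinal ltk') = Ordinal ltk by apply: val_inj; apply: ordS_val.
exact: leq_ltn_trans.
Qed.

(** Letters with residues [a] and [a'] modulo [p] are in sorting order iff their
    quotients increase weakly, and strictly when the residues are not
    themselves in order.  This is where d-descents enter. *)
Lemma lexlt_divmod p q q' a a' x x' : a < p -> a' < p -> x != x' ->
  lexlt (p * q + a) x (p * q' + a') x' = (q + lexlt a' x' a x <= q').
Proof.
move=> lta lta'; have [ltq|ltq'|->] := ltngtP q q'.
- have : p * q.+1 <= p * q' by rewrite leq_mul2l ltq orbT.
  by rewrite mulnS; case: (lexlt a' x' a x); rewrite /lexlt; lia.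
- have : p * q'.+1 <= p * q by rewrite leq_mul2l ltq' orbT.
  by rewrite mulnS; case: (lexlt a' x' a x); rewrite /lexlt; lia.
- by rewrite /lexlt; lia.
Qed.

Lemma ltn_tuple_sorted n N (t : n.-tuple 'I_N) :
  reflect (forall m : 'I_n, m.+1 < n -> tnth t m < tnth t (ordS m))
          (sorted ltn (map val t)).
Proof.
have nthE (m : 'I_n) : nth 0 (map val t) m = tnth t m.
  by rewrite (nth_map (tnth t m)) ?size_tuple // -tnth_nth.
apply: (iffP (sortedP 0)) => /= [srt m lt_m|srt k].
  have := srt m; rewrite size_map size_tuple => /(_ lt_m) /=.
  by rewrite -(ordS_val lt_m) !nthE.
rewrite size_map size_tuple => ltk; pose m := Ordinal (ltnW ltk).
by have := srt m ltk; rewrite -!nthE ordS_val.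
Qed.

(** The d-descents of the colored permutation whose [m]-th image is the card
    [u m] with color rank [a m]. *)
Definition descends n (u : 'I_n -> 'I_n) (a : 'I_n -> nat) (m : 'I_n) : bool :=
  if m.+1 == n then a m != 0 else lexlt (a (ordS m)) (u (ordS m)) (a m) (u m).

Definition ndescends n (u : 'I_n -> 'I_n) (a : 'I_n -> nat) k : nat :=
  \sum_(j < n | j < k) descends u a j.

Lemma ndescendsS n u a (m : 'I_n) :
  ndescends u a m.+1 = ndescends u a m + descends u a m.
Proof.
rewrite /ndescends (bigD1 m) //= addnC; congr (_ + _); apply: eq_bigl => j.
by rewrite -val_eqE /=; lia.
Qed.

Lemma ndescends_le n (u : 'I_n -> 'I_n) a k : k <= n -> ndescends u a k <= k.
Proof.
elim: k => [|k IH] ltk; first by rewrite /ndescends big1.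
have := ndescendsS u a (Ordinal ltk); have := IH (ltnW ltk); rewrite /=.
by case: descends => /=; lia.
Qed.

Lemma ndescends_card n (u : 'I_n -> 'I_n) a : ndescends u a n = #|[set m | descends u a m]|.
Proof.
rewrite -sum1_card [RHS]big_mkcond /ndescends.
by apply: eq_big => [m | m _]; rewrite ?ltn_ord ?inE //; case: descends.
Qed.

(** With [q m] the quotient of the [m]-th listed letter, the numbers
    [q m + m - #(descents before m)] increase strictly precisely when the
    letters are in sorting order, and they stay below [n + c - #descents]
    precisely when the last letter is at most [p c].  This identifies the words
    with the [n]-subsets of an ordinal, in the form of increasing tuples. *)
Lemma card_words n p c (u : 'I_n -> 'I_n) (a : 'I_n -> nat) :
  injective u -> (forall m, a m < p) -> 0 < n ->
  #|[set A : word (p * c).+1 n | [forall m : 'I_n, (A (u m) %% p == a m) &&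
        ((m.+1 < n) ==> wordlt A (u m) (u (ordS m)))]]|
  = 'C(n + c - #|[set m | descends u a m]|, n).
Proof.
move=> inju lta n_gt0; set X := [set A | _]; pose D := ndescends u a.
have DS (m : 'I_n) : D m.+1 = D m + descends u a m by apply: ndescendsS.
have leDm (m : 'I_n) : D m <= m by apply: ndescends_le; apply: ltnW.
rewrite -ndescends_card -/D; clearbody D; set N := _ - D n.
have p_gt0 : 0 < p by apply: leq_ltn_trans (lta (Ordinal n_gt0)).
pose last := Ordinal (etrans (congr1 (leq^~ n) (prednK n_gt0)) (leqnn n)).
have lastE : last.+1 = n by rewrite /= prednK.
clearbody last.
have le_last (m : 'I_n) : m = last \/ m < last.
  have [lt|gt|/val_inj] := ltngtP m last; [by right| |by left].
  by have := leq_trans (ltn_ord m) (eq_leq (esym lastE)); rewrite ltnS leqNgt gt.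
have neu (m : 'I_n) : m.+1 < n -> u m != u (ordS m) :> nat.
  move=> ltm; apply/eqP=> /val_inj/inju/(congr1 val) /= eqm.
  by move: eqm; rewrite modn_small //; lia.
have descendsE (m : 'I_n) : m.+1 < n ->
    descends u a m = lexlt (a (ordS m)) (u (ordS m)) (a m) (u m).
  by move=> ltm; rewrite /descends ltn_eqF.
(* The letters read off from an increasing tuple; the inverse of the shift
   [q m + m - D m]. *)
pose v (t : n.-tuple 'I_N) m := p * (tnth t m + D m - m) + a m.
pose G (t : n.-tuple 'I_N) : word (p * c).+1 n :=
  [ffun i => inord (v t (invF inju i))].
(* The descent at the last index encodes the bound on the letters. *)
have lastb q : (p * q + a last <= p * c) = (q + descends u a last <= c).
  rewrite /descends lastE eqxx; have := lta last; case: (a last) => [|r] ltr.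
    by rewrite !addn0 leq_pmul2l.
  rewrite addn1; apply/idP/idP => [le_pc|ltq].
    by rewrite -(ltn_pmul2l p_gt0); apply: leq_trans le_pc; rewrite addnS ltnS leq_addr.
  have : p * q.+1 <= p * c by rewrite leq_mul2l ltq orbT.
  by rewrite mulnS; lia.
rewrite -card_ltn_sorted_tuples -/N.
set Y := [set t | _].
have YP t : t \in Y -> (forall m : 'I_n, m.+1 < n -> tnth t m < tnth t (ordS m)).
  by rewrite inE => /ltn_tuple_sorted.
have Yge t : t \in Y -> forall m : 'I_n, m <= tnth t m.
  by move=> /YP; apply: (@increasing_geq _ (fun m => tnth t m)).
have vstep t : t \in Y -> forall m : 'I_n, m.+1 < n ->
    lexlt (v t m) (u m) (v t (ordS m)) (u (ordS m)).
  move=> tY m ltm; rewrite /v lexlt_divmod ?neu // -descendsE // ordS_val //.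
  have := DS m; have := YP t tY m ltm; have := Yge t tY m.
  by move: (tnth t (ordS m) : nat) (tnth t m : nat) => y x; lia.
have vbound t : t \in Y -> forall m, v t m <= p * c.
  move=> tY m; have vlast : v t last <= p * c.
    rewrite /v lastb; have := DS last; have := ltn_ord (tnth t last).
    have := leDm last; have := Yge t tY last; rewrite lastE /N.
    by move: (tnth t last : nat) lastE => x; lia.
  have [->//|ltm] := le_last m; apply: leq_trans vlast.
  pose r (x y : nat * nat) := lexlt x.1 x.2 y.1 y.2.
  have tr : transitive r by move=> x y z; rewrite /r /lexlt; lia.
  have := @homo_ordS _ _ r (fun m => (v t m, u m : nat)) tr (vstep t tY) m last ltm.
  by rewrite /r /lexlt /=; lia.
have GE t : t \in Y -> forall m, G t (u m) = v t m :> nat.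
  by move=> tY m; rewrite ffunE invF_f inordK // ltnS vbound.
rewrite -(card_in_imset (f := G) (D := Y)).
  congr #|pred_of_set _|; apply/setP=> A; apply/idP/imsetP => [|[t tY ->]].
    rewrite inE => /forallP AP.
    pose q m := A (u m) %/ p.
    have AE m : A (u m) = p * q m + a m :> nat.
      have /andP[/eqP <- _] := AP m; rewrite [X in X + _]mulnC; exact: divn_eq.
    have qstep (m : 'I_n) : m.+1 < n -> q m + descends u a m <= q (ordS m).
      move=> ltm; have /andP[_ /implyP/(_ ltm)] := AP m.
      by rewrite /wordlt !AE lexlt_divmod ?neu // -descendsE.
    have qlast : q last + descends u a last <= c.
      by rewrite -lastb -AE -ltnS.
    pose f m := q m + m - D m.
    have fstep (m : 'I_n) : m.+1 < n -> f m < f (ordS m).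
      move=> ltm; have := qstep m ltm; have := DS m.
      have := leDm m; have := leDm (ordS m); rewrite /f ordS_val // => *; lia.
    have fltN m : f m < N.
      have flast : f last < N.
        have := DS last; have := leDm last; rewrite /f lastE /N.
        have := lastE; lia.
      have [->//|ltm] := le_last m; apply: leq_trans flast.
      by rewrite ltnW // ltnS; have := homo_ordS ltn_trans fstep ltm.
    pose t := [tuple Ordinal (fltN m) | m < n].
    have tE m : tnth t m = f m :> nat by rewrite tnth_mktuple.
    have tY : t \in Y by rewrite inE; apply/ltn_tuple_sorted => m ltm; rewrite !tE fstep.
    exists t => //; apply/ffunP=> i; rewrite -(f_invF inju i).
    apply: val_inj; rewrite /= GE // AE /v tE /f; set m := invF _ _.
    by congr (_ * _ + _); have := leDm m; lia.
  rewrite inE; apply/forallP=> m; rewrite !GE // /v mulnC modnMDl modn_small // eqxx /=.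
  by apply/implyP=> ltm; rewrite /wordlt !GE // vstep.
move=> t t' tY t'Y eqG; apply: eq_from_tnth => m; apply: val_inj => /=.
have := congr1 (fun A : word _ _ => A (u m) : nat) eqG.
rewrite !GE // /v => /addIn/eqP; rewrite eqn_pmul2l // => /eqP.
have := Yge t tY m; have := Yge t' t'Y m.
by move: (tnth t m : nat) (tnth t' m : nat) => x y; lia.
Qed.

(** * The number of words with a given shuffle *)

Lemma cact_shuffle b n p (A : word b n) x : cact (shuffle p A) x = shuffle_fun A x.
Proof. by rewrite /cact permE. Qed.

Lemma cact1 n p x : cact (1%g : cperm n p) x = x.
Proof. exact: perm1. Qed.

Lemma cactV n p (s : cperm n p) : cancel (cact s^-1%g) (cact s).
Proof. exact: permKV. Qed.

Lemma cactM n p (s t : cperm n p) x : cact (s * t)%g x = cact t (cact s x).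
Proof. exact: permM. Qed.

Lemma iter_shift n p k (x : csym n p) : iter k (@shift n p) x = (x.1, color_shift k x.2).
Proof.
elim: k => [|k IH].
  by case: x => i r /=; congr pair; apply: ord_inj; rewrite /= add0n modn_small.
by rewrite iterS IH /shift /=; congr pair; apply: ord_inj; rewrite /= -addn1 modnDml addn1.
Qed.

Lemma cact_iter_shift n p (s : cperm n p) k x :
  cact s (iter k (@shift n p) x) = iter k (@shift n p) (cact s x).
Proof. by elim: k => //= k IH; rewrite cact_shift IH. Qed.

Lemma iter_shift0 n p (p_gt0 : 0 < p) (x : csym n p) :
  x = iter x.2 (@shift n p) (x.1, color0 p_gt0).
Proof.
rewrite iter_shift; case: x => i r; congr pair; apply: ord_inj.
by rewrite /= addn0 modn_small.
Qed.

(** A colored permutation is determined by the images of the cards of color 0,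
    since it commutes with the color shift. *)
Lemma cperm_eq n p (p_gt0 : 0 < p) (s t : cperm n p) :
  (forall i, cact s (i, color0 p_gt0) = cact t (i, color0 p_gt0)) -> s = t.
Proof.
move=> eq_st; apply/val_inj/permP=> x.
by rewrite -[LHS]/(cact s x) -[RHS]/(cact t x) (iter_shift0 p_gt0 x) !cact_iter_shift eq_st.
Qed.

(** If two cards of color 0 had images over the same index, these images would
    differ by a color shift, and so would the cards. *)
Lemma cact_fst_inj n p (p_gt0 : 0 < p) (s : cperm n p) :
  injective (fun i => (cact s (i, color0 p_gt0)).1).
Proof.
move=> i j eq1; set o := color0 p_gt0 in eq1.
pose k := (p - (cact s (j, o)).2) + (cact s (i, o)).2.
have: cact s (i, o) = cact s (iter k (@shift n p) (j, o)).
  rewrite cact_iter_shift iter_shift -eq1 [LHS]surjective_pairing; congr pair.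
  apply: ord_inj; rewrite /= /k; set r := (cact s (j, o)).2.
  by rewrite addnAC subnK ?modnDl ?modn_small // ltnW.
by move/perm_inj; rewrite iter_shift => -[].
Qed.

Lemma color_rank_eq0 p (p_gt0 : 0 < p) (r : 'I_p) :
  (color_rank r == 0) = (r == color0 p_gt0).
Proof.
rewrite -val_eqE /color_rank /=; have := ltn_ord r.
have [->|r_gt0 ltr] := posnP r; first by rewrite subn0 modnn.
by rewrite modn_small; lia.
Qed.

(** Expressed through [s^-1] because the words are counted by reading their
    letters in the order in which [s^-1] lists the cards. *)
Lemma shuffle_eq b n p (p_gt0 : 0 < p) (A : word b n) (s : cperm n p) :
  let img m := cact s^-1%g (m, color0 p_gt0) in
  (shuffle p A == s) = [forall m : 'I_n,
     (A (img m).1 %% p == color_rank (img m).2) && (place A (img m).1 == m)].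
Proof.
move=> img.
have actE m : cact (shuffle p A) (img m)
    = (place A (img m).1, color_shift (A (img m).1) (img m).2).
  by rewrite cact_shuffle.
have rankE (r : 'I_p) a : (a %% p == color_rank r) = (color_shift a r == color0 p_gt0).
  rewrite -val_eqE /= /color_rank -(eqn_modDr r) subnK; last exact: ltnW.
  by rewrite modnn.
apply/eqP/forallP => [shA m|imgP].
  have := actE m; rewrite shA cactV rankE => /eqP.
  by rewrite xpair_eqE ![_ == place _ _]eq_sym [_ == color_shift _ _]eq_sym andbC.
suff eq1 : (s^-1 * shuffle p A)%g = 1%g :> cperm n p.
  by apply: (mulgI s^-1%g); rewrite mulVg.
refine (@cperm_eq n p p_gt0 _ 1%g _) => m.
have /andP[] := imgP m; rewrite rankE => /eqP colE /eqP placeE.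
by rewrite cact1 cactM actE colE placeE.
Qed.

(** The listing of the cards by [s^-1] turns its d-descents into the descents
    of [card_words]. *)
Lemma card_shuffle n p c (p_gt0 : 0 < p) (s : cperm n p) : 0 < n ->
  #|[set A : word (p * c).+1 n | shuffle p A == s]|
  = 'C(n + c - ndesc p_gt0 s^-1%g, n).
Proof.
move=> n_gt0; pose img m := cact s^-1%g (m, color0 p_gt0).
pose u (m : 'I_n) : 'I_n := (img m).1; pose a (m : 'I_n) := color_rank (img m).2.
have inju : injective u by apply: cact_fst_inj.
have lta m : a m < p by rewrite ltn_mod.
have -> : ndesc p_gt0 s^-1%g = #|[set m | descends u a m]|.
  congr #|pred_of_set _|; apply/setP=> m; rewrite !inE /ddescent /descends.
  case: ifP => // _; by rewrite color_rank_eq0.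
rewrite -(card_words c inju lta n_gt0); congr #|pred_of_set _|; apply/setP=> A.
rewrite !inE (shuffle_eq p_gt0); apply/forallP/forallP => AP m.
  have /andP[-> /eqP placem] := AP m; apply/implyP=> ltm.
  have /andP[_ /eqP placeS] := AP (ordS m).
  by rewrite -place_lt placem placeS (ordS_val ltm).
have /andP[-> _] := AP m; apply/eqP.
have step (m1 : 'I_n) : m1.+1 < n -> wordlt A (u m1) (u (ordS m1)).
  by move=> ltm; have /andP[_ /implyP] := AP m1; apply.
have mono := homo_ordS (@wordlt_trans _ _ A) step.
have -> : place A (u m) = invF inju (u m); last by rewrite invF_f.
apply: place_eq; first exact: (can_inj (f_invF inju)).
move=> i j; rewrite -{1}(f_invF inju i) -{1}(f_invF inju j).
move: (invF inju i) (invF inju j) => k k'.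
case: (ltngtP k k') => // [/mono lt lt'|/val_inj ->]; last by rewrite wordlt_irr.
by have := wordlt_trans lt lt'; rewrite wordlt_irr.
Qed.

(** * Composition of shuffles *)

(** Sorting by [A] and then stably by [B] is sorting by the two-digit number
    [D i] whose leading digit is the letter that [B] gives to the place of
    [i]. *)
Lemma comp_shuffle b1 b2 n p (A : word b1 n) (B : word b2 n) (D : word (b2 * b1) n) :
  b1 = 1 %[mod p] -> (forall i, D i = B (place A i) * b1 + A i :> nat) ->
  Defs.comp (shuffle p B) (shuffle p A) = shuffle p D.
Proof.
move=> b1mod DE.
have placeD : place D =1 (fun i => place B (place A i)).
  apply: place_eq => [i j /place_inj/place_inj // | i j].
  rewrite place_lt {1}/wordlt !DE.
  have [ltB|ltB|eqB] := ltngtP (B (place A i)) (B (place A j)).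
  - by rewrite /wordlt /lexlt ltB.
  - have := leq_mul ltB (leqnn b1); have := ltn_ord (A j).
    by rewrite mulSn /lexlt; lia.
  rewrite /wordlt eqB /lexlt ltnn eqxx /= place_lt /wordlt /lexlt.
  by rewrite ltn_add2l eqn_add2l.
apply/val_inj/permP=> -[i r]; rewrite -[LHS]/(cact _ _) -[RHS]/(cact _ _).
rewrite compE !cact_shuffle /shuffle_fun /= placeD; congr pair.
apply: ord_inj; rewrite /= DE modnDmr -!addnA -modnDml -[RHS]modnDml.
by congr ((_ + _) %% _); rewrite -[RHS]modnMmr b1mod modnMmr muln1.
Qed.

Local Open Scope ring_scope.

Lemma merge_subproof b1 b2 n (A : word b1 n) (B : word b2 n) i :
  (B (place A i) * b1 + A i < b2 * b1)%N.
Proof.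
have := leq_mul (ltn_ord (B (place A i))) (leqnn b1); have := ltn_ord (A i).
by rewrite mulSn; lia.
Qed.

Definition merge b1 b2 n (AB : word b1 n * word b2 n) : word (b2 * b1) n :=
  [ffun i => Ordinal (merge_subproof AB.1 AB.2 i)].

(** The last digits are the letters of [A]; once [A] is known, so is its placement,
    which is onto, and the leading digits give [B]. *)
Lemma merge_inj b1 b2 n : injective (@merge b1 b2 n).
Proof.
move=> [A B] [A' B'] eqD.
have eqi i : (B (place A i) * b1 + A i = B' (place A' i) * b1 + A' i)%N.
  by have := congr1 (fun D : word _ _ => D i : nat) eqD; rewrite !ffunE.
have eqA : A = A'.
  apply/ffunP=> i; apply: val_inj => /=.
  by have := congr1 (modn^~ b1) (eqi i); rewrite !modnMDl !modn_small.
rewrite -eqA in eqi *; congr pair; apply/ffunP=> j.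
rewrite -(f_invF (@place_inj _ _ A) j); apply: val_inj => /=.
set i := invF _ j; have /addIn/eqP := eqi i.
by rewrite eqn_pmul2r ?(leq_ltn_trans _ (ltn_ord (A i))) // => /eqP.
Qed.

Lemma merge_bij b1 b2 n : bijective (@merge b1 b2 n).
Proof.
apply: inj_card_bij (@merge_inj b1 b2 n) _.
by rewrite card_prod !card_ffun !card_ord expnMn mulnC.
Qed.

Lemma card_shuffle_comp b1 b2 n p (t : cperm n p) : b1 = 1 %[mod p] ->
  #|[set D : word (b2 * b1) n | shuffle p D == t]|
  = (\sum_(s : cperm n p) #|[set A : word b1 n | shuffle p A == s]|
      * #|[set B : word b2 n | shuffle p B == Defs.comp t s^-1%g]|)%N.
Proof.
move=> b1mod.
transitivity (\sum_(AB : word b1 n * word b2 n)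
                (Defs.comp (shuffle p AB.2) (shuffle p AB.1) == t))%N.
  rewrite -sum1_card; under eq_bigl do rewrite inE.
  rewrite (reindex (@merge b1 b2 n)) /=; last exact/onW_bij/merge_bij.
  rewrite big_mkcond; apply: eq_bigr => -[A B] _ /=.
  rewrite -(comp_shuffle (A := A) (B := B) b1mod) => [|i]; last by rewrite ffunE.
  by case: eqP.
rewrite -(pair_bigA _ (fun A B =>
  nat_of_bool (Defs.comp (shuffle p B) (shuffle p A) == t))) /=.
under [RHS]eq_bigr => s _.
  rewrite -sum1_card big_distrl /=.
  under eq_bigl do rewrite inE.
  over.
rewrite [RHS](exchange_big_dep xpredT) //=; apply: eq_bigr => A _.
under [RHS]eq_bigl do rewrite eq_sym.
rewrite big_pred1_eq mul1n -sum1_card [RHS]big_mkcond; apply: eq_bigr => B _.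
rewrite inE /Defs.comp (can2_eq (mulKg (shuffle p A)) (mulKVg (shuffle p A))).
by case: eqP.
Qed.

(** * Matrices of group algebra elements *)

(** The matrix whose action on row vectors is left multiplication by [x].  The
    order of the factors is that of the transition matrix. *)
Definition galg_mx (C : numClosedFieldType) n p (x : galg C n p) : 'M[C]_#|cperm n p| :=
  \matrix_(i, j) x (Defs.comp (enum_val j) (enum_val i)^-1%g).

Lemma gmulE (C : numClosedFieldType) n p (x y : galg C n p) s :
  gmul x y s = \sum_b x (Defs.comp s b^-1%g) * y b.
Proof.
rewrite ffunE (reindex_onto (fun b => (Defs.comp s b^-1%g, b)) snd) /=.
  by apply: eq_bigl => b; rewrite /Defs.comp mulKVg !eqxx.
by move=> [a b] /eqP <-; rewrite /Defs.comp mulKg.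
Qed.

Lemma galg_mxE (C : numClosedFieldType) n p (x : galg C n p) s t :
  galg_mx x (enum_rank s) (enum_rank t) = x (Defs.comp t s^-1%g).
Proof. by rewrite mxE !enum_rankK. Qed.

Lemma sum_galg_mx (C : numClosedFieldType) n p (F : 'I_#|cperm n p| -> C) :
  \sum_k F k = \sum_s F (enum_rank s).
Proof.
rewrite (reindex enum_rank) //.
by exists enum_val => s _; rewrite ?enum_rankK ?enum_valK.
Qed.

Lemma row_galg_mulmx (C : numClosedFieldType) n p (x : galg C n p) h :
  row_galg (h *m galg_mx x) = gmul x (row_galg h).
Proof.
apply/ffunP=> s; rewrite gmulE ffunE mxE sum_galg_mx; apply: eq_bigr => b _.
by rewrite galg_mxE ffunE mulrC.
Qed.

(** Acting on the other side exchanges the two group elements in the entries,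
    hence the inversion; it is the reason why right eigenvectors involve [f]
    where left ones involve [e]. *)
Lemma col_galg_mulmx (C : numClosedFieldType) n p (x y : galg C n p) h :
  (forall s, y s = x s^-1%g) ->
  col_galg (galg_mx x *m h) = gmul y (col_galg h).
Proof.
move=> yx; apply/ffunP=> s; rewrite gmulE ffunE mxE sum_galg_mx; apply: eq_bigr => b _.
by rewrite galg_mxE ffunE yx /Defs.comp invMg invgK.
Qed.

(** Every diagonal entry is the coefficient at the identity. *)
Lemma mxtrace_galg_mx (C : numClosedFieldType) n p (x : galg C n p) :
  \tr (galg_mx x) = #|cperm n p|%:R * x 1%g.
Proof.
rewrite /mxtrace (eq_bigr (fun=> x 1%g)) ?sumr_const ?card_ord ?mulr_natl // => i _.
by rewrite mxE /Defs.comp mulVg.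
Qed.

Definition shuffle_mx (C : numClosedFieldType) b n p : 'M[C]_#|cperm n p| :=
  galg_mx [ffun s => #|[set A : word b n | shuffle p A == s]|%:R : C^o].

Lemma trans_mxE (C : numClosedFieldType) b n p :
  trans_mx C b n p = (b ^ n)%:R^-1 *: shuffle_mx C b n p.
Proof. by apply/matrixP=> i j; rewrite !mxE ffunE mulrC. Qed.

Lemma shuffle_mx_mul (C : numClosedFieldType) b1 b2 n p : b1 = 1 %[mod p] ->
  shuffle_mx C b1 n p *m shuffle_mx C b2 n p = shuffle_mx C (b2 * b1) n p.
Proof.
move=> b1mod; apply/matrixP=> i j; rewrite !mxE ffunE card_shuffle_comp // natr_sum.
rewrite sum_galg_mx (reindex_inj (@mulgI _ (enum_val i))) /=; apply: eq_bigr => s _.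
by rewrite !mxE !ffunE natrM enum_rankK /Defs.comp mulKg invMg mulgA.
Qed.

Lemma shuffle1 n p (A : word 1 n) : shuffle p A = 1%g.
Proof.
apply/val_inj/permP=> -[i r]; rewrite perm1 -[LHS]/(cact _ _) cact_shuffle.
rewrite /shuffle_fun (@place_eq _ _ A id) //=.
  by congr pair; apply: ord_inj; rewrite /= ord1 add0n modn_small.
by move=> {}i j; rewrite /wordlt /lexlt !ord1 ltnn eqxx.
Qed.

Lemma shuffle_mx1 (C : numClosedFieldType) n p : shuffle_mx C 1 n p = 1%:M.
Proof.
apply/matrixP=> i j; rewrite !mxE ffunE /Defs.comp -(inj_eq enum_val_inj).
rewrite eq_mulVg1; under eq_finset do rewrite shuffle1 eq_sym.
case: eqP => _; last by rewrite cards0.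
by rewrite cardsT card_ffun !card_ord exp1n.
Qed.

(** * The shuffle polynomials *)

Lemma leq_ell n p : (ell n p <= n)%N.
Proof. by rewrite /ell; case: ifP => // _; apply: leq_pred. Qed.

(** When [p = 1] there is only one color, so the last index is never a
    d-descent. *)
Lemma ndesc_ell n p (p_gt0 : (0 < p)%N) (s : cperm n p) :
  (0 < n)%N -> (ndesc p_gt0 s <= ell n p)%N.
Proof.
move=> n_gt0; rewrite /ndesc /ell; case: eqP => [p1|_]; last first.
  by rewrite (leq_trans (max_card _)) ?card_ord.
subst p; have ltn1 : (n.-1 < n)%N by rewrite prednK.
rewrite -ltnS prednK // -[X in (_ < X)%N]card_ord -cardsT.
apply/proper_card/properP; split; first exact: subsetT.
exists (Ordinal ltn1); rewrite ?inE // /ddescent /= prednK // eqxx.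
by rewrite !ord1.
Qed.

Lemma ndesc1 n p (p_gt0 : (0 < p)%N) : ndesc p_gt0 (1%g : cperm n p) = 0%N.
Proof.
apply/eqP; rewrite cards_eq0; apply/eqP/setP=> m; rewrite !inE /ddescent.
rewrite !cact1; case: eqP => [_|/eqP neq]; first by rewrite eqxx.
rewrite /csym_lt /= ltnn eqxx /=; have := ltn_ord m.
by move=> ltm; rewrite modn_small; lia.
Qed.

Lemma shuffle_poly_bin (C : numClosedFieldType) n p c i : (0 < p)%N -> (i <= n)%N ->
  (shuffle_poly C n p i).[(p * c).+1%:R] = 'C(n + c - i, n)%:R.
Proof.
move=> p_gt0 le_in; rewrite /shuffle_poly /binp hornerZ horner_prod.
set N := (n + c - i)%N.
have NE : N%:R = n%:R + c%:R - i%:R :> C.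
  by rewrite natrB ?natrD // (leq_trans le_in) ?leq_addr.
clearbody N.
have pC : p%:R != 0 :> C by rewrite pnatr_eq0 -lt0n.
rewrite (eq_bigr (fun k : 'I_n => N%:R - k%:R : C)) => [|k _]; last first.
  by rewrite !hornerE NE -addn1 natrD natrM addrK mulKf.
have -> : \prod_(k < n) (N%:R - k%:R : C) = (N ^_ n)%:R.
  rewrite ffact_prod natr_prod; have [le_nN|ltNn] := leqP n N.
    by apply: eq_bigr => k _; rewrite natrB // (leq_trans (ltnW (ltn_ord k))).
  rewrite (bigD1 (Ordinal ltNn)) //= subrr mul0r.
  by rewrite (bigD1 (Ordinal ltNn)) //= subnn mul0r.
by rewrite -bin_ffact natrM mulrC mulfK // pnatr_eq0 -lt0n fact_gt0.
Qed.

(** Comparison of coefficients for matrix polynomials known at the infinitely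
    many pile numbers [p c + 1]. *)
Lemma poly_mx_eq0 (F : numFieldType) m r s p (A : 'I_m -> 'M[F]_(r, s))
    (e : 'I_m -> nat) :
  (0 < p)%N -> injective e ->
  (forall c, \sum_k (p * c).+1%:R ^+ e k *: A k = 0) -> forall k, A k = 0.
Proof.
move=> p_gt0 inje sumA0 k; apply/matrixP=> i j; rewrite mxE.
pose q : {poly F} := \sum_l A l i j *: 'X^(e l).
have q_coef : q`_(e k) = A k i j.
  rewrite coef_sum (bigD1 k) //= big1 => [|l lk]; rewrite coefZ coefXn.
    by rewrite eqxx mulr1 addr0.
  by rewrite (inj_eq inje) eq_sym (negPf lk) mulr0.
rewrite -q_coef; pose rs := [seq (p * c).+1%:R : F | c <- iota 0 (size q)].
suff -> : q = 0 by rewrite coef0.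
apply: (@roots_geq_poly_eq0 _ _ rs); last by rewrite size_map size_iota.
  apply/allP=> _ /mapP[c _ ->]; apply/eqP; rewrite horner_sum.
  transitivity ((\sum_l (p * c).+1%:R ^+ e l *: A l) i j); last by rewrite sumA0 mxE.
  by rewrite summxE; apply: eq_bigr => l _; rewrite !hornerE mxE mulrC.
rewrite map_inj_uniq ?iota_uniq // => c c' /eqP.
by rewrite eqr_nat eqSS eqn_pmul2l // => /eqP.
Qed.

Lemma scale_neq0 (C : numClosedFieldType) n p : (0 < p)%N ->
  (p ^ n * n`!)%:R != 0 :> C.
Proof. by move=> p_gt0; rewrite pnatr_eq0 -lt0n muln_gt0 expn_gt0 p_gt0 fact_gt0. Qed.

Lemma scaled_shuffle_poly (C : numClosedFieldType) n p i : (0 < p)%N ->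
  (p ^ n * n`!)%:R *: shuffle_poly C n p i
  = \prod_(k < n) ('X + (p%:R * (n%:R - i%:R - k%:R) - 1)%:P).
Proof.
move=> p_gt0; have pC : p%:R != 0 :> C by rewrite pnatr_eq0 -lt0n.
rewrite /shuffle_poly /binp scalerA natrM mulfK ?pnatr_eq0 -?lt0n ?fact_gt0 //.
rewrite natrX -{1}(card_ord n) -prodr_const -scaler_prod; apply: eq_bigr => k _.
have pVp : p%:R%:P * p%:R^-1%:P = 1 :> {poly C} by rewrite -polyCM divff.
rewrite -!mul_polyC !(polyCB, polyCM) 3!mulrDr [p%:R%:P * (_ * _)]mulrA pVp.
by ring.
Qed.

Lemma SFC_coef (C : numClosedFieldType) p m r : (0 < p)%N ->
  (\prod_(k < m) ('X + (p * k.+1 - 1)%:R%:P : {poly C}))`_r = (SFC p m r)%:R.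
Proof.
move=> p_gt0; elim: m r => [|m IH] r; first by rewrite big_ord0 coef1.
rewrite big_ord_recr /= mulrDr coefD coefMX coefMC !IH natrD natrM mulrC.
by congr (_ + _); case: r => [|r]; rewrite ?IH.
Qed.

(** All factors [x + (p k - 1)] have positive coefficients, except that for
    [p = 1] the first factor is [x]; only the constant coefficient of the
    product then vanishes. *)
Lemma SFC_gt0 p m r : (0 < p)%N -> (r <= m)%N -> (p = 1%N -> (0 < r)%N \/ m = 0%N) ->
  (0 < SFC p m r)%N.
Proof.
move=> p_gt0; elim: m r => [|m IH] r /= le_rm r_gt0.
  by rewrite leqn0 in le_rm; rewrite le_rm.
have [p1|p_gt1] : p = 1%N \/ (1 < p)%N by lia.
  subst p; case: r le_rm r_gt0 => [|r] le_rm; first by case/(_ erefl).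
  move=> _; case: r le_rm => [|r] le_rm; last by rewrite addn_gt0 IH // => _; left.
  case: m IH {le_rm} => [|m] IH //.
  rewrite addn_gt0 muln_gt0 (IH 1%N) // => [|_]; last by left.
  by rewrite orbC mul1n subn1.
have pos (k : nat) : (0 < p * k.+1 - 1)%N by rewrite subn_gt0 mulnS ltn_addr.
case: r le_rm {r_gt0} => [|r] le_rm.
  by rewrite add0n muln_gt0 pos IH //; move=> p1; rewrite p1 in p_gt1.
by rewrite addn_gt0 IH // => p1; rewrite p1 in p_gt1.
Qed.

(** * Idempotents and spectral resolutions *)

(** In a rank factorization [E = L R], idempotency forces [R L] to be the
    identity of size [\rank E], and [R L] has the same trace as [L R]. *)
Lemma mxtrace_idem (F : fieldType) n (E : 'M[F]_n) :
  E *m E = E -> \tr E = (\rank E)%:R.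
Proof.
move=> idE; have := mulmx_base E.
have /row_freeP[A] := row_base_free E; have /row_fullP[B] := col_base_full E.
move: (row_base E) (col_base E); move: (\rank E) B A => r B A R L BL RA defE.
have RL : R *m L = 1%:M.
  have: B *m (E *m E) *m A = B *m E *m A by rewrite idE.
  by rewrite -defE -!mulmxA RA mulmx1 !mulmxA BL mul1mx.
by rewrite -{1}defE mxtrace_mulC RL mxtrace1.
Qed.

(** A diagonal matrix has the same row space as the idempotent that marks its
    nonzero entries, whose rank is a trace. *)
Lemma mxrank_diag (F : numFieldType) n (d : 'rV[F]_n) :
  \rank (diag_mx d) = #|[set i | d 0 i != 0]|.
Proof.
pose e : 'rV[F]_n := \row_i (d 0 i != 0)%:R.
have eqm : (diag_mx d :=: diag_mx e)%MS.
  apply/eqmxP/andP; split; apply/submxP.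
    exists (diag_mx d); rewrite mulmx_diag; congr diag_mx; apply/rowP=> i.
    by rewrite !mxE; case: eqP => [->|_]; rewrite ?mul0r ?mulr1.
  exists (diag_mx (\row_i (d 0 i)^-1)); rewrite mulmx_diag; congr diag_mx.
  apply/rowP=> i; rewrite !mxE; case: eqP => [->|/eqP nz]; first by rewrite mulr0.
  by rewrite mulVf.
rewrite eqm; apply: (mulrIn (@oner_neq0 F)); rewrite -mxtrace_idem; last first.
  rewrite mulmx_diag; congr diag_mx; apply/rowP=> i; rewrite !mxE.
  by rewrite -natrM mulnb andbb.
rewrite mxtrace_diag -sum1_card natr_sum [RHS]big_mkcond; apply: eq_bigr => i _.
by rewrite !mxE inE; case: eqP.
Qed.

(** Both sides count the occurrences of [a] on the diagonal form of [A]. *)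
Lemma mup_char_poly (F : numFieldType) n (A : 'M[F]_n) a :
  diagonalizable A -> mup a (char_poly A) = \rank (eigenspace A a).
Proof.
case=> P Pu /(similar_diagLR Pu)[d defA].
have {}defA : A = invmx P *m diag_mx d *m P by rewrite defA conjVmx.
have charA : char_poly A = \prod_(x <- [seq d 0 i | i <- enum 'I_n]) ('X - x%:P).
  transitivity (char_poly (diag_mx d)); last first.
    rewrite char_poly_trig ?diag_mx_is_trig // big_image /=.
    by apply: eq_bigr => i _; rewrite mxE eqxx mulr1n.
  have PuX : map_mx (polyC : _ -> {poly F}) P \in unitmx by rewrite map_unitmx.
  rewrite /char_poly /char_poly_mx.
  have -> : 'X%:M - map_mx polyC A = invmx (map_mx polyC P)
      *m ('X%:M - map_mx polyC (diag_mx d)) *m map_mx polyC P.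
    rewrite mulmxBr mulmxBl scalar_mxC mulmxKV //.
    by rewrite defA !map_mxM map_invmx.
  by rewrite !det_mulmx mulrAC -det_mulmx mulVmx // det1 mul1r.
rewrite charA mu_prod_XsubC /eigenspace mxrank_ker.
have -> : A - a%:M = invmx P *m diag_mx (d - const_mx a) *m P.
  rewrite raddfB /= diag_const_mx mulmxBr mulmxBl -defA scalar_mxC.
  by rewrite mulmxKV.
rewrite mxrankMfree ?row_free_unit // eqmxMfull ?row_full_unit ?unitmx_inv //.
set isa := preim (d 0) (pred1 a).
have cntC := count_predC isa (enum 'I_n); rewrite size_enum_ord in cntC.
rewrite mxrank_diag count_map -[X in (X - _)%N]cntC cardsE cardE size_filter -enumT.
rewrite -[LHS](addnK (count (predC isa) (enum 'I_n))); congr (_ - _)%N.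
by apply: eq_count => i; rewrite /= unfold_in !mxE subr_eq0.
Qed.

(** The eigenprojections of a diagonalizable matrix, whose eigenvalues are
    supplied separately as an injective family.  Zero members are allowed, so
    an index need not correspond to an eigenvalue. *)
Definition is_resolution (F : fieldType) m N (E : 'I_m -> 'M[F]_N) : Prop :=
  \sum_j E j = 1%:M
  /\ forall j k, E j *m E k = if j == k then E k else 0.

Lemma spectral_mulr (F : fieldType) m N (E : 'I_m -> 'M[F]_N) (a : 'I_m -> F) :
  is_resolution E -> forall k, (\sum_j a j *: E j) *m E k = a k *: E k.
Proof.
move=> [_ orthE] k; rewrite mulmx_suml (bigD1 k) //= big1 => [|j /negPf jk].
  by rewrite addr0 -scalemxAl orthE eqxx.
by rewrite -scalemxAl orthE jk scaler0.
Qed.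

Lemma spectral_mull (F : fieldType) m N (E : 'I_m -> 'M[F]_N) (a : 'I_m -> F) :
  is_resolution E -> forall k, E k *m (\sum_j a j *: E j) = a k *: E k.
Proof.
move=> [_ orthE] k; rewrite mulmx_sumr (bigD1 k) //= big1 => [|j jk].
  by rewrite addr0 -scalemxAr orthE eqxx.
by rewrite -scalemxAr orthE eq_sym (negPf jk) scaler0.
Qed.

(** The component [h *m E j] of an eigenvector is killed by [a j - a k]. *)
Lemma spectral_row (F : fieldType) m N (E : 'I_m -> 'M[F]_N) (a : 'I_m -> F) :
  injective a -> is_resolution E ->
  forall q (h : 'M_(q, N)) k,
  h *m (\sum_j a j *: E j) = a k *: h <-> exists x, h = x *m E k.
Proof.
move=> inja resE q h k; have [sumE _] := resE; split=> [hP|[x ->]]; last first.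
  by rewrite -mulmxA spectral_mull // scalemxAr.
exists h; rewrite -[LHS]mulmx1 -sumE mulmx_sumr (bigD1 k) //= big1 ?addr0 // => j jk.
have /eqP : (a j - a k) *: (h *m E j) = 0.
  by rewrite scalerBl scalemxAr -(spectral_mulr a resE) mulmxA hP scalemxAl subrr.
by rewrite scaler_eq0 subr_eq0 (inj_eq inja) (negPf jk) => /eqP.
Qed.

Lemma spectral_col (F : fieldType) m N (E : 'I_m -> 'M[F]_N) (a : 'I_m -> F) :
  injective a -> is_resolution E ->
  forall q (h : 'M_(N, q)) k,
  (\sum_j a j *: E j) *m h = a k *: h <-> exists x, h = E k *m x.
Proof.
move=> inja resE q h k; have [sumE orthE] := resE.
have [|HL HR] := @spectral_row F m N (fun j => (E j)^T) a inja _ q h^T k.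
  split=> [|i j]; first by rewrite -[RHS]trmx1 -sumE raddf_sum.
  by rewrite -trmx_mul orthE eq_sym; case: eqP => [->|]; rewrite ?trmx0.
have trZ (r s : nat) (x : F) (M : 'M_(r, s)) : x *: M^T = (x *: M)^T.
  by apply/matrixP=> u v; rewrite !mxE.
have trP : \sum_j a j *: (E j)^T = (\sum_j a j *: E j)^T.
  by rewrite raddf_sum; apply: eq_bigr => j _; rewrite trZ.
rewrite trP -trmx_mul trZ in HL HR; split.
  move=> /(congr1 trmx)/HL[x hx]; exists x^T.
  by rewrite -[h]trmxK hx trmx_mul trmxK.
case=> x hx; apply/trmx_inj/HR; exists x^T.
by rewrite hx trmx_mul.
Qed.

Lemma spectral_eigenspace (F : fieldType) m N (E : 'I_m -> 'M[F]_N) (a : 'I_m -> F) :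
  injective a -> is_resolution E ->
  forall k, (eigenspace (\sum_j a j *: E j) (a k) :=: E k)%MS.
Proof.
move=> inja resE k; apply/eqmxP/andP; split; last first.
  by apply/eigenspaceP; rewrite spectral_mull.
apply/submxP/(spectral_row inja resE); exact/eigenspaceP.
Qed.

Lemma spectral_diagonalizable (F : fieldType) m N (E : 'I_m -> 'M[F]_N) (a : 'I_m -> F) :
  injective a -> is_resolution E ->
  diagonalizable (\sum_j a j *: E j).
Proof.
move=> inja resE; have [sumE _] := resE; apply/diagonalizablePeigen.
exists [seq a i | i <- enum 'I_m]; first by rewrite map_inj_uniq // enum_uniq.
apply/eqmxP; rewrite submx1 big_image /= -sumE summx_sub // => k _.
by rewrite (sumsmx_sup k) // spectral_eigenspace.
Qed.

Lemma spectral_eigenvalue (F : fieldType) m N (E : 'I_m -> 'M[F]_N) (a : 'I_m -> F) :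
  injective a -> is_resolution E ->
  forall x, eigenvalue (\sum_j a j *: E j) x <-> exists2 k, E k != 0 & x = a k.
Proof.
move=> inja resE x; have [sumE _] := resE; split=> [|[k nzE ->]]; last first.
  by rewrite /eigenvalue -mxrank_eq0 spectral_eigenspace // mxrank_eq0.
case/eigenvalueP => v vP nzv.
have /existsP[k nzvE] : [exists k, v *m E k != 0].
  apply: contraNT nzv; rewrite negb_exists => /forallP vE0.
  rewrite -[v]mulmx1 -sumE mulmx_sumr big1 // => k _.
  by apply/eqP; rewrite -[_ == _]negbK.
exists k; first by apply: contraNneq nzvE => ->; rewrite mulmx0.
have /eqP : (x - a k) *: (v *m E k) = 0.
  rewrite scalerBl [a k *: _]scalemxAr -(spectral_mulr a resE).
  by rewrite mulmxA vP scalemxAl subrr.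
by rewrite scaler_eq0 (negPf nzvE) orbF subr_eq0 => /eqP.
Qed.

(** * The eigenspaces of the shuffle *)

(** Indexed by the exponent of the eigenvalue [b^-k] to which it belongs. *)
Definition e_mx (C : numClosedFieldType) n p (p_gt0 : (0 < p)%N) (k : 'I_(ell n p).+1) :
    'M[C]_#|cperm n p| :=
  galg_mx (e_ C n p_gt0 (ell n p - k)).

Lemma galg_mx_sum (C : numClosedFieldType) n p m (a : 'I_m -> C) (F : 'I_m -> galg C n p) :
  galg_mx (\sum_k a k *: F k) = \sum_k a k *: galg_mx (F k).
Proof.
apply/matrixP=> i j; rewrite mxE summxE sum_ffunE; apply: eq_bigr => k _.
by rewrite !mxE ffunE.
Qed.

Lemma sum_Theta (C : numClosedFieldType) n p (p_gt0 : (0 < p)%N) (a : nat -> C) s :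
  (0 < n)%N ->
  (\sum_(i < (ell n p).+1) a i *: Theta C n p_gt0 i) s = a (ndesc p_gt0 s^-1%g).
Proof.
move=> n_gt0; rewrite sum_ffunE.
have ltd : (ndesc p_gt0 s^-1%g < (ell n p).+1)%N by rewrite ltnS ndesc_ell.
rewrite (bigD1 (Ordinal ltd)) //= big1 ?addr0 => [|i neq_i].
  by rewrite !ffunE eqxx [_ *: _]mulr1.
rewrite -val_eqE /= in neq_i.
by rewrite !ffunE eq_sym (negPf neq_i) [_ *: _]mulr0.
Qed.

Lemma e_coef (C : numClosedFieldType) n p (p_gt0 : (0 < p)%N) k s :
  (0 < n)%N -> (k <= ell n p)%N ->
  e_ C n p_gt0 (ell n p - k) s = (shuffle_poly C n p (ndesc p_gt0 s^-1%g))`_(n - k).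
Proof.
move=> n_gt0 le_k; rewrite /e_ /xcoef subKn //.
by rewrite (sum_Theta p_gt0 (fun i => (shuffle_poly C n p i)`_(n - k))).
Qed.

Lemma f_inv_e (C : numClosedFieldType) n p (p_gt0 : (0 < p)%N) m s :
  f_ C n p_gt0 m s = e_ C n p_gt0 m s^-1%g.
Proof.
rewrite /f_ /e_ /xcoef !sum_ffunE; apply: eq_bigr => i _.
by rewrite !ffunE invgK.
Qed.

(** The number of words is the value at [b] of the polynomial that defines the
    [e_k]. *)
Lemma shuffle_mxE (C : numClosedFieldType) n p (p_gt0 : (0 < p)%N) c : (0 < n)%N ->
  shuffle_mx C (p * c).+1 n p
  = \sum_(k < (ell n p).+1) (p * c).+1%:R ^+ (n - k) *: e_mx C p_gt0 k.
Proof.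
move=> n_gt0; rewrite -galg_mx_sum -xcoefE //; congr galg_mx; apply/ffunP=> s.
rewrite (sum_Theta p_gt0 (fun i => (shuffle_poly C n p i).[(p * c).+1%:R])) // ffunE.
rewrite (card_shuffle c p_gt0) // shuffle_poly_bin //.
by rewrite (leq_trans (max_card _)) ?card_ord.
Qed.

Lemma exponent_inj n p : (0 < n)%N -> injective (fun k : 'I_(ell n p).+1 => (n - k)%N).
Proof.
move=> n_gt0 j k eq_jk; apply: val_inj => /=.
have le_n (i : 'I_(ell n p).+1) : (i <= n)%N.
  exact: leq_trans (leq_ord i) (leq_ell n p).
by rewrite -(subKn (le_n j)) eq_jk subKn.
Qed.

(** The coefficients of [b1^(n-k)] in [S_b1 S_b2 = S_(b2 b1)], for fixed
    [b2]. *)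
Lemma e_mx_shuffle (C : numClosedFieldType) n p (p_gt0 : (0 < p)%N) c k : (0 < n)%N ->
  e_mx C p_gt0 k *m shuffle_mx C (p * c).+1 n p
  = (p * c).+1%:R ^+ (n - k) *: e_mx C p_gt0 k.
Proof.
move=> n_gt0; apply/eqP; rewrite -subr_eq0; apply/eqP; move: k.
apply: (poly_mx_eq0 p_gt0 (@exponent_inj n p n_gt0)) => c'.
have b1mod m : (p * m).+1 = 1 %[mod p] by rewrite -addn1 mulnC modnMDl.
under eq_bigr do rewrite scalerBr scalemxAl scalerA -exprMn -natrM.
rewrite sumrB -mulmx_suml -shuffle_mxE // shuffle_mx_mul //.
have -> : ((p * c').+1 * (p * c).+1 = (p * (p * c * c' + c + c')).+1)%N by ring.
have -> : ((p * c).+1 * (p * c').+1 = (p * (p * c * c' + c + c')).+1)%N by ring.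
by rewrite -shuffle_mxE // subrr.
Qed.

(** The coefficients of [b2^(n-k)] in [E_j S_b2 = b2^(n-j) E_j]. *)
Lemma e_mx_orth (C : numClosedFieldType) n p (p_gt0 : (0 < p)%N) j k : (0 < n)%N ->
  e_mx C p_gt0 j *m e_mx C p_gt0 k
  = if j == k then e_mx C p_gt0 k else 0 :> 'M_#|cperm n p|.
Proof.
move=> n_gt0; apply/eqP; rewrite -subr_eq0; apply/eqP; move: k.
apply: (poly_mx_eq0 p_gt0 (@exponent_inj n p n_gt0)) => c.
under eq_bigr do rewrite scalerBr scalemxAr.
rewrite sumrB -mulmx_sumr -shuffle_mxE // e_mx_shuffle // (bigD1 j) //= eqxx.
by rewrite big1 ?addr0 ?subrr // => k; rewrite eq_sym => /negPf ->; rewrite scaler0.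
Qed.

(** With one pile the shuffle does nothing. *)
Lemma sum_e_mx (C : numClosedFieldType) n p (p_gt0 : (0 < p)%N) : (0 < n)%N ->
  \sum_k e_mx C p_gt0 k = 1%:M :> 'M_#|cperm n p|.
Proof.
move=> n_gt0; rewrite -shuffle_mx1 -(muln0 p) shuffle_mxE //.
by apply: eq_bigr => k _; rewrite muln0 expr1n scale1r.
Qed.

Lemma e_mx_resolution (C : numClosedFieldType) n p (p_gt0 : (0 < p)%N) :
  (0 < n)%N -> is_resolution (e_mx C (n := n) p_gt0).
Proof. by move=> n_gt0; split=> [|j k]; [exact: sum_e_mx | exact: e_mx_orth]. Qed.

Lemma shuffle_poly_lead (C : numClosedFieldType) n p i : (0 < p)%N ->
  (shuffle_poly C n p i)`_n = (p ^ n * n`!)%:R^-1.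
Proof.
move=> p_gt0; have nz := scale_neq0 C n p_gt0.
apply: (mulfI nz); rewrite divff // -coefZ scaled_shuffle_poly //.
set q := \prod_(k < n) _.
pose rt (k : 'I_n) : C := 1 - p%:R * (n%:R - i%:R - k%:R).
have -> : q = \prod_(a <- [seq rt k | k <- enum 'I_n]) ('X - a%:P).
  by rewrite big_map big_enum; apply: eq_bigr => k _; rewrite -opprB polyCN.
set s := map _ _; have szs : size s = n by rewrite size_map size_enum_ord.
have := monic_prod_XsubC s xpredT id; rewrite monicE lead_coefE.
by rewrite size_prod_XsubC szs => /eqP.
Qed.

(** All entries of the idempotent [E_0] are equal, to the leading coefficient
    common to all shuffle polynomials; squaring such a matrix multiplies its
    entries by that coefficient times the group order. *)
Lemma card_cperm (C : numClosedFieldType) n p : (0 < n)%N -> (0 < p)%N ->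
  #|cperm n p|%:R = (p ^ n * n`!)%:R :> C.
Proof.
move=> n_gt0 p_gt0; have nz := scale_neq0 C n p_gt0.
have e0E (i j : 'I_#|cperm n p|) : e_mx C p_gt0 ord0 i j = (p ^ n * n`!)%:R^-1.
  by rewrite mxE (e_coef C p_gt0 _ n_gt0 (leq_ord ord0)) subn0 shuffle_poly_lead.
have i0 : 'I_#|cperm n p| := enum_rank 1%g.
have := e_mx_orth C p_gt0 ord0 ord0 n_gt0; rewrite eqxx => /matrixP/(_ i0 i0).
rewrite mxE (eq_bigr _ (fun k _ => congr2 *%R (e0E i0 k) (e0E k i0))) e0E.
rewrite sumr_const card_ord => eqa.
apply: (mulfI (invr_neq0 nz)); rewrite mulVf //.
by apply: (mulfI (invr_neq0 nz)); rewrite mulr1 -[RHS]eqa mulr_natr mulrnAr.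
Qed.

Lemma u0_SFC (C : numClosedFieldType) n p j : (0 < p)%N ->
  u0 C n p j * (p ^ n * n`!)%:R = (SFC p n (n - j))%:R.
Proof.
move=> p_gt0; rewrite mulrC /u0 -coefZ scaled_shuffle_poly // -SFC_coef //.
congr (_ : {poly C})`_(_); rewrite (reindex_inj rev_ord_inj) /=; apply: eq_bigr => k _.
congr ('X + _%:P); rewrite [RHS]natrB ?muln_gt0 ?p_gt0 // natrM subr0.
by rewrite -natrB ?leq_subr // subKn.
Qed.

Lemma rank_e_mx (C : numClosedFieldType) n p (p_gt0 : (0 < p)%N)
    (k : 'I_(ell n p).+1) : (0 < n)%N ->
  (\rank (e_mx C p_gt0 k))%:R = u0 C n p k * (p ^ n * n`!)%:R.
Proof.
move=> n_gt0; rewrite -mxtrace_idem ?e_mx_orth ?eqxx // mxtrace_galg_mx.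
by rewrite e_coef ?leq_ord // invg1 ndesc1 card_cperm // mulrC.
Qed.

Lemma e_mx_neq0 (C : numClosedFieldType) n p (p_gt0 : (0 < p)%N)
    (k : 'I_(ell n p).+1) : (0 < n)%N ->
  e_mx C p_gt0 k != 0.
Proof.
move=> n_gt0; rewrite -mxrank_eq0 -(pnatr_eq0 C) rank_e_mx // u0_SFC // pnatr_eq0 -lt0n.
apply: SFC_gt0 => //; first exact: leq_subr.
move=> p1; left; have := leq_ord k; move: (k : nat) => m.
by rewrite /ell p1 eqxx subn_gt0 -ltnS prednK.
Qed.

Lemma trans_mx_spectral (C : numClosedFieldType) n p (p_gt0 : (0 < p)%N) c : (0 < n)%N ->
  trans_mx C (p * c).+1 n p
  = \sum_(k < (ell n p).+1) (p * c).+1%:R ^- k *: e_mx C p_gt0 k.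
Proof.
move=> n_gt0; rewrite trans_mxE (shuffle_mxE C p_gt0) // scaler_sumr.
have nz : (p * c).+1%:R != 0 :> C by rewrite pnatr_eq0.
apply: eq_bigr => k _; rewrite scalerA natrX.
have le_kn : (k <= n)%N by apply: leq_trans (leq_ord k) (leq_ell n p).
congr (_ *: _); rewrite -{1}(subnK le_kn) exprD invfM mulrAC.
by rewrite mulVf ?mul1r ?expf_neq0.
Qed.

Lemma row_galg_bij (C : numClosedFieldType) n p : bijective (@row_galg C n p).
Proof.
exists (fun x : galg C n p => \row_i x (enum_val i)) => [h|x].
  by apply/rowP=> i; rewrite mxE ffunE enum_valK.
by apply/ffunP=> s; rewrite ffunE mxE enum_rankK.
Qed.

Lemma col_galg_bij (C : numClosedFieldType) n p : bijective (@col_galg C n p).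
Proof.
exists (fun x : galg C n p => \col_i x (enum_val i)) => [h|x].
  by apply/colP=> i; rewrite mxE ffunE enum_valK.
by apply/ffunP=> s; rewrite ffunE mxE enum_rankK.
Qed.

Lemma row_range (C : numClosedFieldType) n p (A : galg C n p) h :
  in_range_L A (row_galg h) <-> exists x, h = x *m galg_mx A.
Proof.
have [g gK Kg] := @row_galg_bij C n p; split=> [[y hy]|[x ->]].
  by exists (g y); apply: (can_inj gK); rewrite row_galg_mulmx Kg.
by exists (row_galg x); rewrite row_galg_mulmx.
Qed.

Lemma col_range (C : numClosedFieldType) n p (A B : galg C n p) h :
  (forall s, B s = A s^-1%g) ->
  in_range_L B (col_galg h) <-> exists x, h = galg_mx A *m x.
Proof.
have [g gK Kg] := @col_galg_bij C n p; move=> BA; split=> [[y hy]|[x ->]].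
  by exists (g y); apply: (can_inj gK); rewrite (col_galg_mulmx _ BA) Kg.
by exists (col_galg x); rewrite (col_galg_mulmx _ BA).
Qed.

Theorem theorem3p7 (C : numClosedFieldType) (n p c : nat)
    (n_gt0 : (0 < n)%N) (p_gt0 : (0 < p)%N) (c_gt0 : (0 < c)%N) :
  let b := (p * c + 1)%N in
  let P := trans_mx C b n p in
  let l := ell n p in
  [/\ forall a : C, eigenvalue P a <-> exists2 j, (j <= l)%N & a = b%:R ^- j,
      forall j, (j <= l)%N -> forall h : 'rV[C]_#|cperm n p|,
        h *m P = b%:R ^- j *: h <->
        in_range_L (e_ C n p_gt0 (l - j)%N) (row_galg h),
      forall j, (j <= l)%N -> forall h : 'cV[C]_#|cperm n p|,
        P *m h = b%:R ^- j *: h <->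
        in_range_L (f_ C n p_gt0 (l - j)%N) (col_galg h)
    & forall j, (j <= l)%N ->
        [/\ (mup (b%:R ^- j) (char_poly P))%:R = u0 C n p j * (p ^ n * n`!)%:R,
            u0 C n p j * (p ^ n * n`!)%:R = (SFC p n (n - j))%:R :> C
          & \rank (eigenspace P (b%:R ^- j)) = mup (b%:R ^- j) (char_poly P)]].
Proof.
rewrite addn1 => b P l; pose a (k : 'I_l.+1) : C := b%:R ^- k.
have inja : injective a.
  move=> j k /invr_inj/ieexprIn eq_jk; apply: ord_inj; apply: eq_jk.
    by rewrite ltr0n.
  by rewrite pnatr_eq1 eqSS -lt0n muln_gt0 p_gt0.
have resE := e_mx_resolution C p_gt0 n_gt0.
have PE : P = \sum_k a k *: e_mx C p_gt0 k by apply: trans_mx_spectral.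
have ordP j : (j <= l)%N -> {k : 'I_l.+1 | j = k}.
  by move=> lej; exists (Ordinal (lej : j < l.+1)%N).
rewrite PE; split.
- move=> x; rewrite (spectral_eigenvalue inja resE); split=> [[k _ ->]|[j /ordP[k ->] ->]].
    by exists k; rewrite ?leq_ord.
  by exists k; rewrite // e_mx_neq0.
- by move=> j /ordP[k ->] h; rewrite (spectral_row inja resE h k) row_range.
- move=> j /ordP[k ->] h; rewrite (spectral_col inja resE h k).
  by rewrite (col_range _ (f_inv_e C p_gt0 (l - k))).
move=> j /ordP[k ->]; rewrite mup_char_poly; last exact: spectral_diagonalizable.
by rewrite (spectral_eigenspace inja resE k) rank_e_mx // u0_SFC.
Qed.
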